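(* Let $n\ge 1$ and let $c:S_n\to S_n$ be the map that applies RSK to a permutation $\pi$ to get a pair $(S,T)$ and then returns the column reading word of the recording tableau $T$. Then: \begin{itemize} \item The map $c$ preserves the shape of the Young tableaux obtained under RSK: for every $\pi\in S_n$, the tableaux in $\mathrm{RSK}(c(\pi))$ have the same shape as the tableaux in $\mathrm{RSK}(\pi)$. \item If $c$ is iterated starting with any permutation $\pi\in S_n$, it reaches a fixed point of $c$ in at most two steps. \item For each partition $\lambda$ of $n$ there is exactly one fixed point $\sigma_\lambda$ of $c$ whose RSK tableaux have shape $\lambda$, and $\mathrm{RSK}(\sigma_\lambda)=(Q_\lambda,Q_\lambda)$. Moreover, $\sigma_\lambda$ is the column reading word of $Q_\lambda$. \end{itemize}
   Context: $S_n$ is the set of permutations of $1,2,\ldots,n$, written as words $\pi=\pi_1,\ldots,\pi_n$. A Young diagram of a partition $\lambda=(\lambda_1\ge\cdots\ge\lambda_k>0)$ of $n$ is drawn in French notation: left-justified rows, with $\lambda_i$ boxes in the $i$-th row from the bottom. A standard Young tableau (SYT) of shape $\lambda$ is a filling of the boxes with $1,\ldots,n$, each used once, with rows increasing left to right and columns increasing bottom to top. RSK: for $\pi\in S_n$, $\mathrm{RSK}(\pi)=(S,T)$, where $S$ (the insertion tableau) is obtained by starting from the empty tableau and inserting $\pi_1,\pi_2,\ldots,\pi_n$ in order. To insert $a$ into a row (starting with the bottom row): if $a$ is larger than every entry of the row, place $a$ at the end of the row and stop; otherwise $a$ replaces the leftmost entry $b$ of the row that is greater than $a$, and $b$ is then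 inserted into the next row up by the same rule. The recording tableau $T$ has the same shape as $S$, with the box that is newly created when inserting $\pi_i$ labeled $i$. RSK is a bijection from $S_n$ to pairs of SYT of size $n$ of the same shape. The column reading word of an SYT is the permutation formed by reading each column downwards (top to bottom), taking the columns in order from left to right. Let $\lambda'$ be the transpose partition of $\lambda$, so $\lambda'_i$ is the length of the $i$-th column of $\lambda$. $Q_\lambda$ is the SYT of shape $\lambda$ formed by filling the first (leftmost) column, from bottom to top, with $1,2,\ldots,\lambda_1'$, then the second column, from bottom to top, with $\lambda_1'+1,\ldots,\lambda_1'+\lambda_2'$, and so on. *)

(* Defs.v *)
From mathcomp Require Import all_boot all_fingroup.
Set Implicit Arguments.
Unset Strict Implicit.
Unset Printing Implicit Defensive.

(* A tableau is the sequence of its rows, from the bottom row (the first row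
   in French notation) upwards; [shape t] is then the sequence of row lengths
   lambda_1, lambda_2, ... *)
Definition tableau := seq (seq nat).

Definition is_partition_of (n : nat) (la : seq nat) : bool :=
  [&& sorted geq la, 0 \notin la & sumn la == n].

(* The second component is the index (0 for the bottom row) of the row in
   which the new box is created. *)
Fixpoint insert (a : nat) (t : tableau) : tableau * nat :=
  if t is r :: t' then
    let k := find (fun b => a < b) r in
    if k < size r then
      let: (u, i) := insert (nth 0 r k) t' in (set_nth 0 r k a :: u, i.+1)
    else (rcons r a :: t', 0)
  else ([:: [:: a]], 0).

(* If row i does not exist yet, it is created. *)
Definition add_box (t : tableau) (i x : nat) : tableau :=
  set_nth [::] t i (rcons (nth [::] t i) x).

(* [ax] is the pair of a letter and its (1-based) position in the word. *)
Definition rsk_step (ST : tableau * tableau) (ax : nat * nat) :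
    tableau * tableau :=
  let: (S', i) := insert ax.1 ST.1 in (S', add_box ST.2 i ax.2).

Definition rsk_word (w : seq nat) : tableau * tableau :=
  foldl rsk_step ([::], [::]) (zip w (iota 1 (size w))).

(* Entries of the (0-based) column j, from bottom to top. *)
Definition column (t : tableau) (j : nat) : seq nat :=
  [seq nth 0 r j | r <- t & j < size r].

Definition ncols (t : tableau) : nat := \max_(r <- t) size r.

Definition column_word (t : tableau) : seq nat :=
  flatten [seq rev (column t j) | j <- iota 0 (ncols t)].

(* The length of the (0-based) column j of the diagram of la. *)
Definition col_len (la : seq nat) (j : nat) : nat := count (fun l => j < l) la.

(* In box (row i, column j), both 0-based, stands
   lambda'_1 + ... + lambda'_j + (i + 1). *)
Definition Qtab (la : seq nat) : tableau :=
  [seq [seq (\sum_(k < j) col_len la k) + i.+1 | j <- iota 0 (nth 0 la i)]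
     | i <- iota 0 (size la)].

(* 'S_n acts on {0, ..., n-1}; words have letters 1, ..., n. *)
Definition word n (s : 'S_n) : seq nat := [seq (s i : nat).+1 | i <- enum 'I_n].

Definition RSK n (s : 'S_n) : tableau * tableau := rsk_word (word s).

Definition has_RSK_shape n (s : 'S_n) (la : seq nat) : Prop :=
  shape (RSK s).1 = la /\ shape (RSK s).2 = la.

Definition word_fun n (w : seq nat) (i : 'I_n) : 'I_n :=
  insubd i (nth 0 w i).-1.

Lemma word_funE n w (i : 'I_n) :
  perm_eq w (iota 1 n) -> (word_fun w i : nat).+1 = nth 0 w i.
Proof.
move=> w_perm; have: nth 0 w i \in w.
  by rewrite mem_nth // (perm_size w_perm) size_iota.
rewrite (perm_mem w_perm) mem_iota add1n => /andP[w_gt0 w_lt].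
by rewrite val_insubd -ltnS prednK // w_lt prednK.
Qed.

Lemma word_fun_inj n w :
  perm_eq w (iota 1 n) -> injective (word_fun w : 'I_n -> 'I_n).
Proof.
move=> w_perm i j eq_ij; apply/val_inj/eqP => /=.
have size_w : size w = n by rewrite (perm_size w_perm) size_iota.
rewrite -(nth_uniq 0 (s := w)) ?size_w ?(perm_uniq w_perm) ?iota_uniq //.
by rewrite -!word_funE // eq_ij.
Qed.

Definition word_perm n w (w_perm : perm_eq w (iota 1 n)) : 'S_n :=
  perm (word_fun_inj w_perm).

Lemma word_permK n w (w_perm : perm_eq w (iota 1 n)) :
  word (word_perm w_perm) = w.
Proof.
have size_w : size w = n by rewrite (perm_size w_perm) size_iota.
apply: (@eq_from_nth _ 0) => [|i]; rewrite size_map size_enum_ord ?size_w //.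
move=> lt_in; rewrite (nth_map (Ordinal lt_in)) ?size_enum_ord // permE.
by rewrite word_funE // nth_enum_ord.
Qed.

Lemma perm_add_box t i x : perm_eq (flatten (add_box t i x)) (x :: flatten t).
Proof.
elim: t i => [|r t IHt] [|i] //=.
- by rewrite /add_box /=; elim: i.
- by rewrite -cat_cons perm_cat2r perm_rcons.
by rewrite -[x :: _]cat1s perm_sym perm_catCA perm_cat2l perm_sym; apply: IHt.
Qed.

Lemma perm_rsk_word w : perm_eq (flatten (rsk_word w).2) (iota 1 (size w)).
Proof.
have step z ST : perm_eq (flatten (foldl rsk_step ST z).2)
                         (flatten ST.2 ++ unzip2 z).
  elim: z ST => [|[a x] z IHz] ST /=; first by rewrite cats0.
  apply: perm_trans (IHz _) _; rewrite /rsk_step /=.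
  case: insert => S' i /=; rewrite -cat_rcons perm_cat2r.
  by rewrite (permPl (perm_add_box _ _ _)) perm_sym perm_rcons.
by apply: perm_trans (step _ _) _; rewrite /= unzip2_zip // size_iota.
Qed.

Lemma perm_column_word t : perm_eq (column_word t) (flatten t).
Proof.
apply/seq.permP => p; rewrite !count_flatten !sumnE !big_map.
pose F (r : seq nat) j := (j < size r) && p (nth 0 r j).
transitivity (\sum_(j <- iota 0 (ncols t)) \sum_(r <- t) (F r j : nat)).
  apply: eq_bigr => j _; rewrite count_rev count_map count_filter.
  by rewrite -sum1_count big_mkcond; apply: eq_bigr => r _ /=; rewrite andbC.
rewrite exchange_big /= !(big_nth [::]) !big_mkord; apply: eq_bigr => k _.
set r := nth [::] t k; have le_r: size r <= ncols t.
  by apply: (leq_bigmax_seq (F := size)); rewrite ?mem_nth.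
rewrite -sum1_count [RHS](big_nth 0) [RHS]big_mkcond /=.
rewrite -{1}(subnKC le_r) iotaD big_cat /= add0n [X in _ + X]big1_seq ?addn0.
  rewrite /index_iota subn0 !big_seq.
  by apply: eq_bigr => j; rewrite mem_iota /F => /andP[_ ->]; case: (p _).
by move=> j /andP[_]; rewrite mem_iota /F [j < size r]ltnNge => /andP[-> _].
Qed.

Lemma recording_column_word n (s : 'S_n) :
  perm_eq (column_word (RSK s).2) (iota 1 n).
Proof.
apply: perm_trans (perm_column_word _) _; apply: perm_trans (perm_rsk_word _) _.
by rewrite size_map size_enum_ord.
Qed.

Definition c n (s : 'S_n) : 'S_n := word_perm (recording_column_word s).

Lemma word_c n (s : 'S_n) : word (c s) = column_word (RSK s).2.
Proof. exact: word_permK. Qed.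

(* Main.v *)
(* Everything follows from one computation: the column word of a semistandard
   tableau T inserts to T itself and is recorded by Q_(shape T).  Indeed,
   reading a column downwards, each new letter enters the bottom row of that
   column and pushes the part already inserted up by one box.  Hence
   RSK (c s) = (T, Q) where T is the recording tableau of s, then
   RSK (c (c s)) = (Q, Q), and a fixed point is the column word of its Q. *)
Require Import Defs.
From mathcomp Require Import all_boot all_fingroup.
Set Implicit Arguments.
Unset Strict Implicit.
Unset Printing Implicit Defensive.

(** * Semistandard tableaux and row insertion *)

Definition dominates (r s : seq nat) : Prop :=
  size s <= size r /\ forall j, j < size s -> nth 0 r j < nth 0 s j.

(** No empty rows, rows weakly increasing, columns strictly increasing upwards. Above the top row
    stands the default [[::]], which every row dominates. *)
Fixpoint ssyt (t : tableau) : Prop :=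
  if t is r :: t' then
    [/\ r != [::], sorted leq r, dominates r (head [::] t') & ssyt t']
  else True.

Lemma ssyt_nth t :
  (forall i, i < size t -> [/\ nth [::] t i != [::], sorted leq (nth [::] t i)
                             & dominates (nth [::] t i) (nth [::] t i.+1)]) ->
  ssyt t.
Proof.
elim: t => //= r t IHt Ht.
have [r_n0 r_sorted r_dom] := Ht 0 isT.
by split=> //; apply: IHt => i; apply: (Ht i.+1).
Qed.

Lemma sorted_shape_ssyt t : ssyt t -> sorted geq (shape t).
Proof.
elim: t => //= r t IHt [_ _ [le_size _] /IHt]; rewrite /shape.
by case: t le_size {IHt} => //= s t -> ->.
Qed.

Lemma shape_ssyt_gt0 t : ssyt t -> 0 \notin shape t.
Proof.
by elim: t => //= r t IHt [r_n0 _ _ /IHt]; rewrite inE negb_or; case: r r_n0.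
Qed.

(** Appending is also [set_nth], at index [size r], so bumping and appending share one formula for
    the bottom row. *)
Lemma insert_cons a r t (k := find (fun b => a < b) r) :
  (insert a (r :: t)).1 =
    set_nth 0 r k a :: (if k < size r then (insert (nth 0 r k) t).1 else t).
Proof.
rewrite /= -/k; have: k <= size r by apply: find_size.
rewrite leq_eqVlt => /predU1P[->|lt_k]; last by rewrite lt_k; case: insert.
rewrite ltnn /=; congr (_ :: _).
by elim: (r) => //= x r' ->.
Qed.

Lemma head_insert a t :
  head [::] (insert a t).1 =
    set_nth 0 (head [::] t) (find (fun b => a < b) (head [::] t)) a.
Proof. by case: t => // r t; rewrite insert_cons. Qed.

Lemma nth_before_find a r j : j < find (fun b => a < b) r -> nth 0 r j <= a.
Proof. by move/(before_find 0)/negbT; rewrite -leqNgt. Qed.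

(** Only the neighbours of position k matter: entries before k are at most a, and a is less than the
    old entry at k, hence than the entry after it. *)
Lemma sorted_set_nth_find a r :
  sorted leq r -> sorted leq (set_nth 0 r (find (fun b => a < b) r) a).
Proof.
set k := find _ _ => r_sorted; apply/(sortedP 0) => i.
rewrite size_set_nth !nth_set_nth /= => lt_i.
have le_k : k <= size r by apply: find_size.
have [eq_ik|ne_ik] := eqVneq i k; have [eq_i1k|ne_i1k] := eqVneq i.+1 k.
- by case: (n_Sn i); rewrite eq_i1k.
- have lt_i1 : i.+1 < size r.
    by move: lt_i; rewrite leq_max ltnS eq_ik ltnn.
  have /(nth_find 0) : has (fun b => a < b) r.
    by rewrite has_find -/k -eq_ik ltnW.
  by rewrite -/k -eq_ik => /ltnW/leq_trans; apply; apply: (sortedP 0 r_sorted).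
- by apply: nth_before_find; rewrite -/k -eq_i1k.
- apply: (sortedP 0 r_sorted); move: lt_i; rewrite leq_max => /orP[|//].
  rewrite ltnS => lt_ik; apply: leq_trans le_k.
  by rewrite ltn_neqAle ne_i1k.
Qed.

(** If s has an entry above b, that entry exceeds b, so b moves up into a column k' <= k. Below it
    then stands a, or an old entry at most a; both are less than b. In the other columns the change
    in r can only lower an entry. *)
Lemma dominates_bump a r s (k := find (fun b => a < b) r) (b := nth 0 r k) :
  k < size r -> dominates r s ->
  dominates (set_nth 0 r k a) (set_nth 0 s (find (fun b' => b < b') s) b).
Proof.
move=> lt_k [le_size r_lt_s]; set k' := find _ s.
have lt_ab : a < b by apply: nth_find; rewrite has_find.
have le_k' : k' <= k.
  have [lt_ks|le_sk] := ltnP k (size s); last exact: leq_trans (find_size _ _) _.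
  rewrite leqNgt; apply/negP => /(before_find 0).
  by rewrite r_lt_s.
split=> [|j]; rewrite !size_set_nth ?(maxn_idPr lt_k).
  by rewrite geq_max le_size (leq_ltn_trans le_k').
rewrite !nth_set_nth /=; have [-> _|ne_j] := eqVneq j k'.
  have [//|ne_k'] := eqVneq k' k; apply: leq_ltn_trans lt_ab.
  by apply: nth_before_find; rewrite ltn_neqAle ne_k'.
rewrite leq_max ltnS => lt_j.
have {}lt_j : j < size s.
  case/orP: lt_j => // le_j; apply: leq_trans (find_size (fun b' => b < b') s).
  by rewrite ltn_neqAle ne_j.
have [eq_jk|_] := eqVneq j k; last exact: r_lt_s.
by rewrite (ltn_trans lt_ab) // /b -eq_jk r_lt_s.
Qed.

Lemma ssyt_insert a t : ssyt t -> ssyt (insert a t).1.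
Proof.
elim: t a => [a _|r t IHt a]; first by split=> //; split.
rewrite insert_cons /= => -[r_n0 r_sorted r_dom t_ss].
split; [by case: (r) r_n0 => //= x r' _; case: ifP |
        exact: sorted_set_nth_find | | by case: ifP => // _; apply: IHt].
case: ifP => [lt_k|ge_k].
  by rewrite head_insert; apply: dominates_bump.
have ->: find (fun b => a < b) r = size r.
  by apply/eqP; rewrite eqn_leq find_size leqNgt ge_k.
have [le_size r_lt] := r_dom.
split=> [|j lt_j]; first by rewrite size_set_nth leq_max le_size orbT.
rewrite nth_set_nth /=; case: eqP => [eq_j|_]; last exact: r_lt.
by move: lt_j; rewrite eq_j ltnNge le_size.
Qed.

(** * Shapes and the recording tableau *)

Lemma shape_insert a t :
  shape (insert a t).1 = incr_nth (shape t) (insert a t).2.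
Proof.
elim: t a => //= r t IHt a; case: ifP => [lt_k|_] /=; last by rewrite size_rcons.
move: (IHt (nth 0 r (find (fun b => a < b) r))); case: insert => u i /= <-.
by rewrite size_set_nth (maxn_idPr lt_k).
Qed.

Lemma shape_add_box t i x : shape (add_box t i x) = incr_nth (shape t) i.
Proof.
elim: t i => [|r t IHt] [|i] //=; last by congr (_ :: _); apply: IHt.
  by rewrite /add_box /=; congr (_ :: _); elim: i => //= i ->.
by rewrite size_rcons.
Qed.

Lemma dominates_rcons r x s : dominates r s -> dominates (rcons r x) s.
Proof.
case=> le_size r_lt; split=> [|j lt_j]; first by rewrite size_rcons ltnW.
by rewrite nth_rcons (leq_trans lt_j le_size) r_lt.
Qed.

Lemma sorted_rcons_leq r x :
  sorted leq r -> all (fun y => y < x) r -> sorted leq (rcons r x).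
Proof.
case: r => // y r r_path r_lt; rewrite /= rcons_path [path _ _ _]r_path /=.
by apply: ltnW; apply: (allP r_lt); apply: mem_last.
Qed.

(** The label x exceeds all entries, so the order conditions at the new box are automatic once the
    new shape is a partition. *)
Lemma ssyt_add_box t i x :
  ssyt t -> all (fun y => y < x) (flatten t) ->
  sorted geq (shape (add_box t i x)) -> 0 \notin shape (add_box t i x) ->
  ssyt (add_box t i x).
Proof.
elim: t i => [|r t IHt] [|i] //=.
  move=> [r_n0 r_sorted r_dom t_ss]; rewrite all_cat => /andP[r_lt _] _ _.
  split=> //; first by case: (r).
    exact: sorted_rcons_leq.
  exact: dominates_rcons.
move=> [r_n0 r_sorted [le_size r_dom] t_ss]; rewrite all_cat => /andP[r_lt t_lt].
rewrite -/(add_box t i x) inE negb_or => sh_path /andP[_ sh_n0].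
split=> //; last by apply: IHt => //; apply: path_sorted sh_path.
(* Only a box added to the row directly above [r] affects domination by [r]; the shape then forces
   that row to have been strictly shorter. *)
case: i sh_path {sh_n0} => [|i]; last by case: (t) le_size r_dom.
move=> sh_path; have {sh_path} lt_size : size (head [::] t) < size r.
  by move: sh_path; rewrite /add_box; case: (t) => [|s t'] /= /andP[];
     rewrite ?size_rcons.
have -> : head [::] (add_box t 0 x) = rcons (head [::] t) x by case: (t).
split=> [|j]; rewrite size_rcons //.
rewrite ltnS nth_rcons => le_j; have lt_jr := leq_ltn_trans le_j lt_size.
have [lt_j|ge_j] := ltnP j (size (head [::] t)); first exact: r_dom.
rewrite eqn_leq le_j ge_j.
by apply: (allP r_lt); apply: mem_nth.
Qed.

Lemma rsk_word_rcons w a :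
  rsk_word (rcons w a) = rsk_step (rsk_word w) (a, (size w).+1).
Proof.
rewrite /rsk_word size_rcons -(addn1 (size w)) iotaD cats1.
by rewrite zip_rcons ?size_iota // foldl_rcons addnC.
Qed.

(** Insertion keeps the first tableau semistandard, so its shape is a partition; the recording
    tableau grows by the same box, with a label above all earlier ones. *)
Lemma rsk_word_ssyt w :
  [/\ ssyt (rsk_word w).1, ssyt (rsk_word w).2
    & shape (rsk_word w).1 = shape (rsk_word w).2].
Proof.
elim/last_ind: w => [|w a [S_ss T_ss eq_shape]]; first by split.
rewrite rsk_word_rcons /rsk_step /=.
have := ssyt_insert a S_ss; have := shape_insert a (rsk_word w).1.
case: insert => S' i /= S'_shape S'_ss.
have eq_shape' : shape S' = shape (add_box (rsk_word w).2 i (size w).+1).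
  by rewrite S'_shape eq_shape shape_add_box.
split=> //; apply: ssyt_add_box => //; rewrite -?eq_shape'.
- by rewrite (perm_all _ (perm_rsk_word w)); apply/allP => y; rewrite mem_iota => /andP[].
- exact: sorted_shape_ssyt.
- exact: shape_ssyt_gt0.
Qed.

(** * Inserting one column read downwards *)

(** Here [u] lists the new column from bottom to top; rows missing in [t] are created. *)
Fixpoint add_column (t : tableau) (u : seq nat) : tableau :=
  if u is x :: u' then rcons (head [::] t) x :: add_column (behead t) u' else t.

Definition rows_le (t : tableau) (u : seq nat) : Prop :=
  forall i, i < size u -> all (fun b => b <= nth 0 u i) (nth [::] t i).

(** In the bottom row everything left of the new column is at most a, so a bumps exactly the last
    entry, which meets the same situation one row higher. The column moves up by one box. *)
Lemma insert_add_column a t u :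
  path ltn a u -> rows_le t (a :: u) ->
  insert a (add_column t u) = (add_column t (a :: u), size u).
Proof.
elim: u a t => [|x u IHu] a t /=.
  case: t => [|r t] //= _ /(_ 0 isT) /= r_le.
  suff /hasPn/negbTE : {in r, forall b, ~~ (a < b)} by rewrite has_find => ->.
  by move=> b /(allP r_le); rewrite -leqNgt.
case/andP=> lt_ax u_path le_t.
have r_le : all (fun b => b <= a) (head [::] t) by have := le_t 0 isT; rewrite nth0.
have -> : find (fun b => a < b) (rcons (head [::] t) x) = size (head [::] t).
  rewrite -cats1 find_cat /= lt_ax addn0; case: hasP => // -[b /(allP r_le)].
  by rewrite leqNgt => /negPf->.
rewrite size_rcons ltnSn nth_rcons ltnn eqxx IHu //=.
  by congr (_ :: _, _); elim: (head _ _) => //= y r ->.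
by move=> i lt_i; have := le_t i.+1 lt_i; rewrite nth_behead.
Qed.

Lemma add_box_add_column t u x :
  add_box (add_column t u) (size u) x = add_column t (rcons u x).
Proof.
elim: u t => [|y u IHu] t; first by case: t.
by congr (_ :: _); apply: IHu.
Qed.

(** The lowest entry is read last, hence the induction from the bottom of [u]. Each new box tops the
    column, so the labels increase upwards. *)
Lemma foldl_rsk_column S T u m :
  sorted ltn u -> rows_le S u ->
  foldl rsk_step (S, T) (zip (rev u) (iota m (size u))) =
    (add_column S u, add_column T (iota m (size u))).
Proof.
elim: u => // x u IHu u_path le_S.
rewrite [size (x :: u)]/= -(addn1 (size u)) iotaD cats1 rev_cons.
rewrite zip_rcons ?size_rev ?size_iota // foldl_rcons IHu; last first.
(* Before x arrives the column sits one row lower: row i is bounded by entry i of [x :: u], which is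
   less than entry i of [u]. *)
- move=> i lt_i; apply: sub_all (le_S i (ltnW lt_i)) => b /leq_trans; apply.
  by apply: ltnW; apply: (pathP 0 u_path).
- exact: path_sorted u_path.
by rewrite /rsk_step /= insert_add_column //= -{2}(size_iota m (size u))
           add_box_add_column.
Qed.

(** * Building a tableau column by column *)

Lemma column_cons r t j :
  column (r :: t) j = if j < size r then nth 0 r j :: column t j else column t j.
Proof. by rewrite /column /=; case: ifP. Qed.

Lemma column_nil t j :
  ssyt t -> size (head [::] t) <= j -> column t j = [::].
Proof.
elim: t => //= r t IHt [_ _ [le_size _] t_ss] le_j.
by rewrite column_cons ltnNge le_j /= IHt // (leq_trans le_size).
Qed.

(* [j = 0] is special: a tableau has no empty rows. *)
Definition first_columns (j : nat) (t : tableau) : tableau :=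
  if j is 0 then [::] else [seq take j r | r <- t].

(** Row lengths decrease weakly upwards, so column j occupies the bottom rows, exactly where
    [add_column] places it. *)
Lemma add_column_first_columns t j :
  ssyt t -> add_column (first_columns j t) (column t j) = first_columns j.+1 t.
Proof.
case: j => [|j] /=.
  elim: t => //= r t IHt [r_n0 _ _ t_ss].
  by rewrite column_cons; case: r r_n0 => //= x r _; rewrite IHt // take0.
elim: t => //= r t IHt [_ _ [le_size _] t_ss].
rewrite column_cons; case: ltnP => [lt_j|ge_j] /=.
  by rewrite IHt // -take_nth.
have nil_j := column_nil t_ss (leq_trans le_size ge_j).
by rewrite -IHt // nil_j /= !take_oversize // ltnW.
Qed.

Lemma sorted_column t j : ssyt t -> sorted ltn (column t j).
Proof.
elim: t => //= r t IHt [_ _ [le_size r_dom] t_ss].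
rewrite column_cons; case: ifP => _; last exact: IHt.
move: (IHt t_ss); case: t le_size r_dom t_ss {IHt} => //= s t le_size r_dom ss.
have := @column_nil (s :: t) j ss; rewrite column_cons /=.
by case: ltnP => [/r_dom /= -> //|le_sj ->].
Qed.

Lemma rows_le_first_columns t j :
  ssyt t -> rows_le (first_columns j t) (column t j).
Proof.
case: j => [|j]; first by move=> _ i; rewrite nth_nil.
elim: t => [|r t IHt] // [_ r_sorted [le_size _] t_ss].
rewrite column_cons; case: ltnP => [lt_j|ge_j]; last first.
  by rewrite (column_nil t_ss (leq_trans le_size ge_j)).
case=> [_|i] /=; last exact: IHt.
apply/(all_nthP 0) => i; rewrite size_take lt_j => lt_i; rewrite nth_take //.
by apply: (sorted_leq_nth leq_trans leqnn 0 r_sorted) => //;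
   rewrite ?inE ?(ltn_trans lt_i) // ltnW.
Qed.

Lemma first_columns_ncols t : ssyt t -> first_columns (ncols t) t = t.
Proof.
case: t => [_|r t [r_n0 _ _ _]]; first by case: ncols.
have: size r <= ncols (r :: t).
  by apply: (leq_bigmax_seq (F := size)); rewrite ?mem_head.
case E: (ncols _) => [|m]; first by case: (r) r_n0.
rewrite -E => _; rewrite /first_columns E -E; apply: map_id_in => s s_t.
by apply: take_oversize; apply: (leq_bigmax_seq (F := size)).
Qed.

(** * The tableau [Qtab la] *)

(** Both sides say that box (i, j) lies in the diagram: the parts exceeding j form a prefix of [la],
    of length [col_len la j]. *)
Lemma gt_nth_col_len la i j :
  sorted geq la -> (j < nth 0 la i) = (i < col_len la j).
Proof.
elim: la i => [|l la IHla] i; first by rewrite nth_nil.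
move=> /[dup] /path_sorted la_sorted /=.
rewrite path_sortedE; last by move=> x y z /= le_xy /leq_trans; apply.
case/andP=> la_le _; rewrite /col_len /= -/(col_len la j).
have [lt_j|le_j] := ltnP j l; first by case: i => //= i; rewrite IHla.
have -> : col_len la j = 0.
  apply/eqP; rewrite -leqn0 leqNgt -has_count; apply/hasPn => x /(allP la_le).
  by rewrite -leqNgt => /leq_trans; apply.
rewrite addn0 ltn0; apply/negbTE; rewrite -leqNgt; case: i => //= i.
have [lt_i|ge_i] := ltnP i (size la); last by rewrite nth_default.
by apply: leq_trans le_j; apply: (allP la_le); apply: mem_nth.
Qed.

Lemma size_Qtab_row la i : size (nth [::] (Qtab la) i) = nth 0 la i.
Proof.
have [lt_i|ge_i] := ltnP i (size la); last first.
  by rewrite !nth_default ?size_map ?size_iota.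
by rewrite (nth_map 0) ?size_iota // size_map size_iota nth_iota.
Qed.

Lemma nth_Qtab la i j :
  j < nth 0 la i ->
  nth 0 (nth [::] (Qtab la) i) j = \sum_(k < j) col_len la k + i.+1.
Proof.
move=> lt_j; have lt_i : i < size la.
  by rewrite ltnNge; apply/negP => ge_i; rewrite nth_default in lt_j.
rewrite (nth_map 0) ?size_iota // nth_iota //.
by rewrite (nth_map 0) ?size_iota // nth_iota.
Qed.

Lemma shape_Qtab la : shape (Qtab la) = la.
Proof.
apply: (@eq_from_nth _ 0); rewrite !size_map size_iota // => i lt_i.
by rewrite (nth_map [::]) ?size_Qtab_row // size_map size_iota.
Qed.

Lemma ssyt_Qtab la : sorted geq la -> 0 \notin la -> ssyt (Qtab la).
Proof.
move=> la_sorted la_n0; apply: ssyt_nth => i.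
rewrite size_map size_iota => lt_i; split.
- rewrite -size_eq0 size_Qtab_row.
  by apply: contraNneq la_n0 => <-; apply: mem_nth.
- apply/(sortedP 0) => j; rewrite size_Qtab_row => lt_j.
  by rewrite !nth_Qtab ?(ltnW lt_j) // big_ord_recr /= leq_add2r leq_addr.
split=> [|j]; rewrite !size_Qtab_row.
  have [lt_i1|ge_i1] := ltnP i.+1 (size la); last by rewrite nth_default.
  exact: (sortedP 0 la_sorted).
move=> lt_j; rewrite !nth_Qtab ?ltn_add2l //.
by move: lt_j; rewrite !gt_nth_col_len //; apply: ltn_trans.
Qed.

Lemma size_column t j : size (column t j) = col_len (shape t) j.
Proof. by rewrite size_map size_filter /col_len count_map. Qed.

(** These are the 1-based positions that column j occupies in a column word of shape [la], hence the
    labels it receives under RSK. *)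
Lemma column_Qtab la j :
  sorted geq la ->
  column (Qtab la) j = iota (\sum_(k < j) col_len la k).+1 (col_len la j).
Proof.
move=> la_sorted; rewrite /column /Qtab filter_map -map_comp.
rewrite (eq_filter (a2 := fun i => i < 0 + col_len la j)); last first.
  by move=> i; rewrite /= size_map size_iota gt_nth_col_len.
rewrite filter_iota_ltn; last exact: count_size.
rewrite -[in RHS](addn0 _.+1) iotaDl; apply/eq_in_map => i.
rewrite mem_iota add0n /= -gt_nth_col_len // => lt_j.
by rewrite (nth_map 0) ?size_iota // nth_iota // addSnnS.
Qed.

(** * RSK of a column word *)

Lemma rsk_word_cat w v :
  rsk_word (w ++ v) =
    foldl rsk_step (rsk_word w) (zip v (iota (size w).+1 (size v))).
Proof. by rewrite /rsk_word size_cat iotaD zip_cat ?size_iota // foldl_cat. Qed.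

(** Induction on j, one column at a time. The length of the word is carried along because it fixes
    the first label of the next column. *)
Lemma rsk_word_first_columns t j
    (w := flatten [seq rev (column t k) | k <- iota 0 j]) :
  ssyt t ->
  rsk_word w = (first_columns j t, first_columns j (Qtab (shape t))) /\
  size w = \sum_(k < j) col_len (shape t) k.
Proof.
rewrite /w => {w} t_ss; have sh_sorted := sorted_shape_ssyt t_ss.
have Q_ss := ssyt_Qtab sh_sorted (shape_ssyt_gt0 t_ss).
elim: j => [|j [IHj size_w]]; first by rewrite big_ord0.
rewrite -addn1 iotaD map_cat flatten_cat /= cats0 add0n addn1 size_cat size_w.
rewrite size_rev size_column big_ord_recr; split=> //.
rewrite rsk_word_cat IHj size_w size_rev foldl_rsk_column ?sorted_column //.
  by rewrite size_column -column_Qtab // !add_column_first_columns.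
exact: rows_le_first_columns.
Qed.

Lemma rsk_column_word t :
  ssyt t -> rsk_word (column_word t) = (t, Qtab (shape t)).
Proof.
move=> t_ss; have [-> _] := rsk_word_first_columns (ncols t) t_ss.
(* The number of columns depends only on the shape, so [t] and its [Qtab] are completed at the same
   j. *)
have ncolsE u : ncols u = \max_(l <- shape u) l by rewrite big_map.
rewrite first_columns_ncols // ncolsE -{1}(shape_Qtab (shape t)) -ncolsE.
rewrite first_columns_ncols //.
by apply: ssyt_Qtab; [apply: sorted_shape_ssyt | apply: shape_ssyt_gt0].
Qed.

(** * Fixed points of [c] *)

Lemma word_inj n : injective (@word n).
Proof.
have nth_word (s : 'S_n) (i : 'I_n) : nth 0 (word s) i = (s i).+1.
  by rewrite /word (nth_map i) ?size_enum_ord // nth_ord_enum.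
move=> s s' eq_w; apply/permP => i; apply/val_inj/succn_inj.
by rewrite /= -!nth_word eq_w.
Qed.

(** No computation with entries: [Qtab la] is the recording tableau of its own column word, and a
    recording tableau contains each label once. *)
Lemma perm_column_word_Qtab n la :
  is_partition_of n la -> perm_eq (column_word (Qtab la)) (iota 1 n).
Proof.
case/and3P=> la_sorted la_n0 /eqP <-.
have := perm_rsk_word (column_word (Qtab la)).
rewrite rsk_column_word ?shape_Qtab /=; last exact: ssyt_Qtab.
have Q_perm := perm_column_word (Qtab la).
rewrite (perm_size Q_perm) size_flatten shape_Qtab.
exact: perm_trans.
Qed.

Lemma RSK_c n (s : 'S_n) : RSK (c s) = ((RSK s).2, Qtab (shape (RSK s).2)).
Proof.
rewrite /RSK word_c rsk_column_word //.
by have [] := rsk_word_ssyt (word s).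
Qed.

Theorem theorem4p3 (n : nat) (n_ge1 : 1 <= n) :
  [/\ forall s : 'S_n, shape (RSK (c s)).1 = shape (RSK s).1 /\
                       shape (RSK (c s)).2 = shape (RSK s).2,
      forall s : 'S_n, exists2 k, k <= 2 & c (iter k (@c n) s) = iter k (@c n) s
    & forall la : seq nat, is_partition_of n la ->
        exists2 sigma : 'S_n,
          unique (fun s : 'S_n => c s = s /\ has_RSK_shape s la) sigma
          & RSK sigma = (Qtab la, Qtab la) /\ word sigma = column_word (Qtab la)].
Proof.
split=> [s|s|la la_part].
- rewrite RSK_c shape_Qtab; split=> //.
  by have [_ _ ->] := rsk_word_ssyt (word s).
(* From [c s] on, the recording tableau is the [Qtab] of an unchanging shape, so [c (c s)] and its
   image have the same word. *)
- exists 2 => //=; apply: word_inj.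
  by rewrite [LHS]word_c [RHS]word_c !RSK_c /= shape_Qtab.
pose Q_perm := perm_column_word_Qtab la_part.
have /and3P[la_sorted la_n0 _] := la_part.
have sigmaE : RSK (word_perm Q_perm) = (Qtab la, Qtab la).
  rewrite /RSK word_permK rsk_column_word ?shape_Qtab //; exact: ssyt_Qtab.
exists (word_perm Q_perm); last by rewrite word_permK.
split=> [|s [s_fix [_ sh_s]]].
  split; last by rewrite /has_RSK_shape sigmaE shape_Qtab.
  by apply: word_inj; rewrite word_c sigmaE word_permK.
(* Writing s as [c (c s)] exhibits its word as the column word of the [Qtab] of its shape. *)
apply: word_inj; rewrite word_permK -s_fix word_c -s_fix RSK_c.
by rewrite sh_s.
Qed.
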